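(* Let $G$ be a connected digraph and let $G[V_1],G[V_2],\ldots,G[V_k]$ be all strongly connected components of $G$. If $G$ has exactly one initial component, then $$\kappa(G)=\kappa\big(\widehat{G[V_1]}\big)\cdot\kappa\big(\widehat{G[V_2]}\big)\cdots\kappa\big(\widehat{G[V_k]}\big).$$
   Context: Digraphs are finite directed graphs without loops; parallel edges are allowed. An arborescence of a digraph $G=(V,E)$ is a subdigraph $A$ spanning all of $V$ with a root vertex from which every vertex is reachable along a unique directed path in $A$ (a rooted directed spanning tree with edges directed away from the root). Arborescences are identified with their edge sets. Let $\mathsf{arb}(G)$ be the set of all arborescences of $G$ (over all roots). Each edge carries a label, which is a polynomial variable; distinct edges of the original digraph $G$ have distinct labels (the edge $e$ itself is used as the variable), and edges of digraphs derived from $G$ keep the label of the edge of $G$ they come from. The Kirchhoff polynomial of a digraph is $\kappa(G)=\sum_{A\in\mathsf{arb}(G)}\prod_{e\in A}e$, where $e$ stands for its label; for a one-vertex digraph $\kappa(G)=1$. $G[V']$ denotes the subdigraph induced by $V'\subseteq V$. A strongly connected component (SCC) of $G$ is an inclusion-maximal strongly connected induced subdigraph; the vertex sets of the SCCs partition $V$. The SCCs are partially ordered by reachability ($G[V_i]\le G[V_j]$ if there is a directed path from $G[V_i]$ to $G[V_j]$); an initial component is a minimal element of this order, i.e. an SCC with no edge entering it from outside. For an SCC $G[V']$ of a digraph $G$ with exactly one initial component, the digraph $\widehat{G[V']}$ is defined as follows. If $G[V']$ is the initial SCC, then $\widehat{G[V']}=G[V']$. Otherwise $\widehat{G[V']}$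 is obtained from $G[V']$ by adding one new vertex $v_{\mathsf{aux}}$ and, for every edge $xy$ of $G$ with $x\notin V'$ and $y\in V'$, adding an edge $v_{\mathsf{aux}}y$ with the same label as $xy$ (different edges $xy$ yield different, possibly parallel, edges). *)

(* Defs.v *)
From HB Require Import structures.
From mathcomp Require Import all_boot all_order all_algebra.
From mathcomp Require Import boolp.
From mathcomp Require Import mpoly.

Set Implicit Arguments.
Unset Strict Implicit.
Unset Printing Implicit Defensive.

Import GRing.Theory.

(* Edges form a type of their own, so parallel edges are allowed.  An edge
   labelled [i] carries the polynomial variable ['X_i]. *)
Record digraph (n : nat) := Digraph {
  vertex : finType;
  edge : finType;
  src : edge -> vertex;
  tgt : edge -> vertex;
  label : edge -> 'I_n;
  loopless : forall e : edge, src e != tgt e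
}.

Arguments Digraph {n vertex edge} src tgt label loopless.
Arguments src {n d} e.
Arguments tgt {n d} e.
Arguments label {n d} e.

Section Digraphs.
Variable n : nat.
Implicit Types G : digraph n.

Section OneDigraph.
Variable G : digraph n.
Implicit Types (A : {set edge G}) (x y : vertex G) (p : seq (edge G)).

Definition adj : rel (vertex G) :=
  [rel x y | [exists e : edge G, (src e == x) && (tgt e == y)]].

Definition connected : bool :=
  (0 < #|vertex G|) &&
  [forall x, forall y, connect [rel u v | adj u v || adj v u] x y].

Definition strongly_connected : bool :=
  (0 < #|vertex G|) && [forall x, forall y, connect adj x y].

Fixpoint dipath A x p y : bool :=
  if p is e :: p' then [&& e \in A, src e == x & dipath A (tgt e) p' y]
  else x == y.

(* [dipath] allows repeated vertices, so the uniqueness below also excludes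
   directed cycles in [A], including those through the root. *)
Definition is_arborescence A : Prop :=
  exists r, forall x, exists! p, dipath A r p x.

Definition arb : {set {set edge G}} := [set A | `[< is_arborescence A >]].

Definition kirchhoff : {mpoly int[n]} :=
  (\sum_(A in arb) \prod_(e in A) 'X_(label e))%R.

End OneDigraph.

Section Induced.
Variables (G : digraph n) (W : {set vertex G}).

Definition induced_vertex := {x : vertex G | x \in W}.
Definition induced_edge := {e : edge G | (src e \in W) && (tgt e \in W)}.
Definition entering_edge := {e : edge G | (src e \notin W) && (tgt e \in W)}.

Definition induced_src (e : induced_edge) : induced_vertex :=
  exist _ (src (val e)) (proj1 (andP (valP e))).
Definition induced_tgt (e : induced_edge) : induced_vertex :=
  exist _ (tgt (val e)) (proj2 (andP (valP e))).
Definition entering_tgt (e : entering_edge) : induced_vertex :=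
  exist _ (tgt (val e)) (proj2 (andP (valP e))).

Lemma induced_loopless (e : induced_edge) : induced_src e != induced_tgt e.
Proof. exact: (loopless (val e)). Qed.

Definition induced : digraph n :=
  Digraph induced_src induced_tgt (fun e => label (val e)) induced_loopless.

(* [None] is the auxiliary vertex. *)
Definition aug_src (e : induced_edge + entering_edge) : option induced_vertex :=
  match e with inl e' => Some (induced_src e') | inr _ => None end.
Definition aug_tgt (e : induced_edge + entering_edge) : option induced_vertex :=
  match e with
  | inl e' => Some (induced_tgt e')
  | inr e' => Some (entering_tgt e')
  end.
Definition aug_label (e : induced_edge + entering_edge) : 'I_n :=
  match e with inl e' => label (val e') | inr e' => label (val e') end.

Lemma aug_loopless (e : induced_edge + entering_edge) : aug_src e != aug_tgt e.
Proof. by case: e => // e; exact: (loopless (val e)). Qed.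

Definition augmented : digraph n :=
  Digraph aug_src aug_tgt aug_label aug_loopless.

End Induced.

Definition sccs G : {set {set vertex G}} :=
  [set W | maxset (fun W' => strongly_connected (induced W')) W].

Definition scc_le G : rel {set vertex G} :=
  [rel W1 W2 : {set vertex G} | [exists x in W1, exists y in W2, connect (@adj G) x y]].

Definition initial_components G : {set {set vertex G}} :=
  [set W in sccs G | [forall W' in sccs G, scc_le W' W ==> (W' == W)]].

Definition hat G (W : {set vertex G}) : digraph n :=
  if W \in initial_components G then induced W else augmented W.

End Digraphs.

(* Main.v *)
(** Sending an edge to the component containing its head splits the edge set of
    [G] into the edge sets of the digraphs [hat W].  An edge set [A] is an
    arborescence with root [r] exactly when no edge of [A] enters [r], distinct
    edges of [A] have distinct heads, and every nonempty vertex set avoiding [r]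
    is entered by [A].  The last condition only has to be tested on sets lying in
    one component: in any [S], a vertex [x] with the fewest ancestors provides an
    edge entering the intersection of [S] with the component of [x], and its tail
    is either in the same component or has fewer ancestors than [x], hence lies
    outside [S].  So [A] is an arborescence of [G] iff each of its pieces is an
    arborescence of the corresponding [hat W], and the product expands into the
    sum. *)

Require Import Defs.
From mathcomp Require Import all_boot all_order all_algebra.
From mathcomp Require Import mpoly.
From mathcomp Require Import boolp.

Set Implicit Arguments.
Unset Strict Implicit.
Unset Printing Implicit Defensive.

(** * Arborescences characterised by roots, heads and cuts *)

Section CutCriterion.
Variables (n : nat) (G : digraph n).
Implicit Types (A : {set edge G}) (r x y : vertex G) (S W : {set vertex G}).

(* For [W] the full vertex set this says that [A] is an arborescence with root
   [r]; when [r] is outside [W] it plays the role of the auxiliary vertex. *)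
Definition rooted_on W A r : Prop :=
  [/\ forall e, e \in A -> tgt e \in W -> tgt e != r,
      {in [set e in A | tgt e \in W] &, injective tgt} &
      forall S, S \subset W -> S != set0 -> r \notin S ->
        exists2 e, e \in A & (tgt e \in S) && (src e \notin S)].

Lemma dipath_rcons A x p e y :
  dipath A x (rcons p e) y = [&& dipath A x p (src e), e \in A & tgt e == y].
Proof.
elim: p x => [|f p IHp] x /=; last by rewrite IHp !andbA.
by rewrite eq_sym; case: (x == src e); rewrite ?andbF ?andbT.
Qed.

Lemma dipath_crosses A S x p y :
  dipath A x p y -> x \notin S -> y \in S ->
  exists2 e, e \in A & (tgt e \in S) && (src e \notin S).
Proof.
elim: p x => [|e p IHp] x /=; first by move=> /eqP-> /negP.
case/and3P=> eA /eqP <- pP xS yS.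
have [tS|tS] := boolP (tgt e \in S); first by exists e; rewrite ?tS.
exact: IHp pP tS yS.
Qed.

(** Compare the two paths from their ends: the last edges share a head and so coincide, and an empty
    path cannot match a nonempty one because no edge of [A] enters [r]. *)
Lemma dipath_inj A r p q x :
    (forall e, e \in A -> tgt e != r) -> {in A &, injective tgt} ->
  dipath A r p x -> dipath A r q x -> p = q.
Proof.
move=> rA injA.
elim/last_ind: p q x => [|p e IHp] q x; elim/last_ind: q => [|q f _] //.
- move=> /= /eqP <-; rewrite dipath_rcons => /and3P[_ fA ft].
  by move: (rA f fA); rewrite ft.
- rewrite dipath_rcons => /and3P[_ eA et] /= /eqP rx.
  by move: (rA e eA); rewrite rx et.
rewrite !dipath_rcons => /and3P[pP eA /eqP et] /and3P[qP fA /eqP ft].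
have ef : e = f by apply: injA => //; rewrite et.
by rewrite -ef in qP *; rewrite (IHp _ _ pP qP).
Qed.

Lemma is_arborescenceP A : is_arborescence A <-> exists r, rooted_on setT A r.
Proof.
split=> [] [r rP]; exists r.
  (* Every edge of [A] ends some path from [r]. If its head were [r], this path would rival the
     empty one; two edges with a common head would give two paths to it. *)
  have inP e : e \in A -> exists p, dipath A r (rcons p e) (tgt e).
    by move=> eA; have [p [pP _]] := rP (src e); exists p; rewrite dipath_rcons pP eA /=.
  split.
  - move=> e eA _; apply/eqP => er; have [p] := inP e eA; rewrite er => pP.
    have [q [_ qU]] := rP r.
    have q0 : q = [::] by apply: qU => /=.
    by have := qU _ pP; rewrite q0; case: (p).
  - move=> e f; rewrite !inE !andbT => eA fA ef.
    have [p pP] := inP e eA; have [q qP] := inP f fA.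
    rewrite -ef in qP; have [s [_ sU]] := rP (tgt e).
    have : rcons p e = rcons q f by rewrite -(sU _ pP) -(sU _ qP).
    by move/rcons_inj => [].
  - move=> S _ /set0Pn[x xS] rS; have [p [pP _]] := rP x.
    exact: dipath_crosses pP rS xS.
case: rP => rA injA cut.
have injA' : {in A &, injective tgt}.
  by move=> e f eA fA; apply: injA; rewrite !inE !andbT.
have rA' e : e \in A -> tgt e != r by move=> eA; apply: rA; rewrite ?inE.
(* No edge of [A] enters the set [U] of vertices that [A] does not reach from [r], so the cut
   condition forces [U] to be empty. *)
pose U := [set y | ~~ `[< exists p, dipath A r p y >]].
have UP y : reflect (exists p, dipath A r p y) (y \notin U).
  by rewrite inE negbK; exact: asboolP.
have U0 : U = set0.
  apply/eqP; apply/negPn/negP => /(cut U (subsetT _)) [].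
    by apply/UP; exists [::] => /=.
  move=> e eA /andP[tU /UP [p pP]]; move: tU; rewrite inE => /negP; apply.
  by apply/asboolP; exists (rcons p e); rewrite dipath_rcons pP eA /=.
move=> x; have /UP [p pP] : x \notin U by rewrite U0 inE.
by exists p; split=> // q; exact: (dipath_inj rA' injA' pP).
Qed.

End CutCriterion.

(** * Arborescences of the digraphs [hat W] as edge sets of [G] *)

Section Pieces.
Variables (n : nat) (G : digraph n) (W : {set vertex G}).
Implicit Types (A : {set edge G}) (r : vertex G).

Definition aug_val (e : edge (augmented W)) : edge G :=
  match e with inl e' => val e' | inr e' => val e' end.

Lemma aug_val_inj : injective aug_val.
Proof.
have noLR (e : induced_edge W) (f : entering_edge W) : val e != val f.
  apply/eqP => ef; have /andP[sW _] := valP e; have /andP[/negP] := valP f.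
  by rewrite -ef sW.
move=> [] e [] f /= ef; try by rewrite (val_inj ef).
  by case/eqP: (noLR e f).
by case/eqP: (noLR f e).
Qed.

(** An edge with head in [W] is induced or entering according to its tail. Edge sets of
    [augmented W] can thus be handled as sets of edges of [G] with heads in [W]. *)
Lemma codom_aug_val e : (e \in codom aug_val) = (tgt e \in W).
Proof.
apply/codomP/idP => [[[] f ->]|tW]; try by case/andP: (valP f).
have [sW|sW] := boolP (src e \in W).
  have eP : (src e \in W) && (tgt e \in W) by rewrite sW.
  by exists (inl (exist _ e eP)).
have eP : (src e \notin W) && (tgt e \in W) by rewrite sW.
by exists (inr (exist _ e eP)).
Qed.

(** The root upstairs must be the auxiliary vertex. Any [r] outside [W] can stand for it, since no
    head in [W] equals [r] and no subset of [W] contains it. *)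
Lemma augmented_arborescenceP A r : r \notin W ->
  is_arborescence (aug_val @^-1: A : {set edge (augmented W)}) <->
  rooted_on W A r.
Proof.
move=> rW.
have tgt_val (e : edge (augmented W)) (y : induced_vertex W) :
    tgt e = Some y -> tgt (aug_val e) = val y.
  by case: e => f [] <-.
have tgt_valW (e : edge (augmented W)) : tgt (aug_val e) \in W.
  by rewrite -codom_aug_val codom_f.
(* For an edge leaving the auxiliary vertex both sides are false: its tail in [G] lies outside
   [W]. *)
have src_in (e : edge (augmented W)) (y : induced_vertex W) :
    (src e == Some y) = (src (aug_val e) == val y).
  case: e => f //=; symmetry; apply/eqP => fy.
  by case/andP: (valP f) => /negP[]; rewrite fy (valP y).
have lift e : tgt e \in W -> exists f, e = aug_val f.
  by rewrite -codom_aug_val => /codomP.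
have tgt_some (e : edge (augmented W)) : {y : induced_vertex W | tgt e = Some y}.
  by case: e => f /=; eexists.
have memT (e : edge (augmented W)) : (tgt e \in [set: vertex (augmented W)]) by rewrite inE.
rewrite is_arborescenceP; split=> [[r' [r'A injA cut]]|[rA injA cut]].
  have r'N : r' = None.
    (* With any other root, the cut condition would demand an edge entering the auxiliary vertex. *)
    case: r' r'A cut => // u r'A cut.
    have N0 : [set None] != set0 :> {set vertex (augmented W)}.
      by apply/set0Pn; exists None; rewrite inE.
    have [|e _] := cut [set None] (subsetT _) N0; first by rewrite inE.
    by have [y ->] := tgt_some e; rewrite inE.
  split.
  - by move=> e _ tW; apply: contraNneq rW => <-.
  - move=> e f; rewrite !inE => /andP[eA tW] /andP[fA uW] ef.
    have [e' ee'] := lift _ tW; have [f' ff'] := lift _ uW; subst e f.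
    congr aug_val; apply: injA; rewrite ?inE ?eA ?fA ?memT //.
    have [y ey] := tgt_some e'; have [z fz] := tgt_some f'.
    rewrite ey fz; congr Some; apply: val_inj.
    by rewrite -(tgt_val _ _ ey) -(tgt_val _ _ fz).
  - move=> S SW /set0Pn[x xS] rS.
    pose S' := [set o : vertex (augmented W) | if o is Some y then val y \in S else false].
    have [|||e] := cut S'; first exact: subsetT.
    - have xW := subsetP SW _ xS.
      by apply/set0Pn; exists (Some (exist _ x xW)); rewrite inE.
    - by rewrite r'N inE.
    rewrite inE => eA; have [y ey] := tgt_some e.
    rewrite ey !inE => /andP[yS sS]; exists (aug_val e) => //.
    rewrite (tgt_val _ _ ey) yS; apply: contra sS => sS.
    have sW := subsetP SW _ sS.
    pose z : induced_vertex W := exist (fun x => x \in W) _ sW.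
    by have := src_in e z; rewrite eqxx => /eqP ->.
exists None; split.
- by move=> e _ _; have [y ->] := tgt_some e.
- move=> e f; rewrite !inE !andbT => eA fA ef.
  apply: aug_val_inj; apply: injA; rewrite ?inE ?eA ?fA ?tgt_valW //.
  have [y ey] := tgt_some e.
  by rewrite (tgt_val _ _ ey) (tgt_val f y) // -ef.
- move=> S _ /set0Pn[[u|] uS NS]; last by rewrite uS in NS.
  pose S' := [set val y | y : induced_vertex W & Some y \in S].
  have S'P (o : vertex (augmented W)) y : o = Some y -> (o \in S) = (val y \in S').
    by move=> ->; rewrite mem_imset ?inE //; exact: val_inj.
  have S'W : S' \subset W.
    by apply/subsetP => _ /imsetP[y _ ->]; exact: valP y.
  have [||e eA /andP[tS sS]] := cut S' S'W.
  - by apply/set0Pn; exists (val u); rewrite -(S'P (Some u)).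
  - by apply: contra rW; exact: (subsetP S'W).
  have [f ff] := lift _ (subsetP S'W _ tS); subst e.
  exists f; first by rewrite inE.
  have [y fy] := tgt_some f.
  rewrite (S'P _ _ fy) -(tgt_val _ _ fy) tS andTb.
  case sf: (src f) => [z|]; last exact: NS.
  rewrite (S'P _ z) //.
  by have /eqP <- : src (aug_val f) == val z by rewrite -src_in sf.
Qed.

Section NoEntering.
Hypothesis closedW : forall e : edge G, tgt e \in W -> src e \in W.

Definition ind_val (e : edge (induced W)) : edge G := val e.

Lemma ind_val_inj : injective ind_val.
Proof. exact: val_inj. Qed.

Lemma codom_ind_val e : (e \in codom ind_val) = (tgt e \in W).
Proof.
apply/codomP/idP => [[f ->]|tW]; first by case/andP: (valP f).
have eP : (src e \in W) && (tgt e \in W) by rewrite tW closedW.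
by exists (exist _ e eP).
Qed.

(** Without an auxiliary vertex the root is a genuine vertex of [W]; by [closedW] no edge of [G]
    with head in [W] is lost in [induced W]. *)
Lemma induced_arborescenceP A :
  is_arborescence (ind_val @^-1: A : {set edge (induced W)}) <->
  exists2 r, r \in W & rooted_on W A r.
Proof.
have lift e : tgt e \in W -> exists f, e = ind_val f.
  by rewrite -codom_ind_val => /codomP.
have tgtW (e : edge (induced W)) : tgt (ind_val e) \in W.
  by rewrite -codom_ind_val codom_f.
rewrite is_arborescenceP; split=> [[r [rA injA cut]]|[r rW [rA injA cut]]].
  exists (val r); first exact: valP r.
  split.
  - move=> e eA tW; have [f ff] := lift _ tW; subst e.
    by have := rA f; rewrite !inE; apply.
  - move=> e f; rewrite !inE => /andP[eA tW] /andP[fA uW] ef.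
    have [e' ee'] := lift _ tW; have [f' ff'] := lift _ uW; subst e f.
    by congr ind_val; apply: injA; rewrite ?inE ?eA ?fA //; exact: val_inj.
  - move=> S SW /set0Pn[x xS] rS.
    pose S' : {set vertex (induced W)} := [set y | val y \in S].
    have [|||e] := cut S'; first exact: subsetT.
    - have xW := subsetP SW _ xS.
      by apply/set0Pn; exists (exist _ x xW); rewrite inE.
    - by rewrite inE.
    by rewrite !inE => eA tS; exists (ind_val e).
exists (exist _ r rW); split.
- by move=> e; rewrite inE => eA _; apply: rA eA (tgtW e).
- move=> e f; rewrite !inE !andbT => eA fA ef.
  apply: ind_val_inj; apply: injA; rewrite ?inE ?eA ?fA ?tgtW //.
  exact: (congr1 val ef).
- move=> S _ /set0Pn[u uS] rS.
  pose S' := [set val y | y in S].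
  have S'P y : (val y \in S') = (y \in S) by rewrite mem_imset //; exact: val_inj.
  have S'W : S' \subset W.
    by apply/subsetP => _ /imsetP[y _ ->]; exact: valP y.
  have [||e eA /andP[tS sS]] := cut S' S'W.
  - by apply/set0Pn; exists (val u); rewrite S'P.
  - by rewrite (S'P (exist _ r rW)).
  have [f ff] := lift _ (subsetP S'W _ tS); subst e.
  exists f; first by rewrite inE.
  by rewrite -!S'P; apply/andP; split.
Qed.

End NoEntering.
End Pieces.

(** * Strong components and the localisation of the cut criterion *)

Section Components.
Variables (n : nat) (G : digraph n).
Implicit Types (A : {set edge G}) (r x y : vertex G) (S W : {set vertex G}).

Definition scc x : {set vertex G} :=
  [set y | connect (@adj n G) x y && connect (@adj n G) y x].

Lemma scc_refl x : x \in scc x.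
Proof. by rewrite inE connect0. Qed.

Lemma scc_eq x y : y \in scc x -> scc y = scc x.
Proof.
rewrite inE => /andP[xy yx]; apply/setP => z; rewrite !inE.
apply/andP/andP => -[h1 h2]; split.
- exact: connect_trans xy h1.
- exact: connect_trans h2 yx.
- exact: connect_trans yx h1.
- exact: connect_trans h2 xy.
Qed.

Lemma connect_edge (e : edge G) : connect (@adj n G) (src e) (tgt e).
Proof. by apply: connect1; apply/existsP; exists e; rewrite !eqxx. Qed.

Lemma connect_induced W (u v : vertex (induced W)) :
  connect (@adj n (induced W)) u v -> connect (@adj n G) (val u) (val v).
Proof.
case/connectP => p; elim: p u => [|w p IHp] u /=; first by move=> _ ->.
case/andP=> /existsP[e /andP[/eqP <- /eqP ew]] pP vP.
apply: connect_trans (IHp _ pP vP); rewrite -ew.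
exact: (connect_edge (val e)).
Qed.

(** A path of [G] between two vertices of the class never leaves it: each vertex on the way is
    reachable from [x] and reaches [x]. *)
Lemma scc_strongly_connected x : strongly_connected (induced (scc x)).
Proof.
apply/andP; split.
  by apply/card_gt0P; exists (exist _ x (scc_refl x)).
apply/forallP => u; apply/forallP => v.
have: connect (@adj n G) (val u) (val v).
  have := valP u; have := valP v; rewrite !inE => /andP[xv _] /andP[_ ux].
  exact: connect_trans ux xv.
case/connectP => p; elim: p u => [|z p IHp] u /=.
  by move=> _ /val_inj ->; exact: connect0.
case/andP=> /existsP[e /andP[/eqP eu' /eqP ez]] pP vP.
have eu : src e = val u := eu'.
have zS : z \in scc x.
  have := valP u; have := valP v; rewrite !inE => /andP[_ vx] /andP[xu _].
  apply/andP; split.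
    by apply: connect_trans xu _; rewrite -eu -ez connect_edge.
  by apply: connect_trans vx; apply/connectP; exists p.
have eP : (src e \in scc x) && (tgt e \in scc x).
  by rewrite eu ez zS (valP u).
apply: connect_trans (IHp (exist _ z zS) pP vP).
apply: connect1; apply/existsP; exists (exist _ e eP : edge (induced (scc x))).
by apply/andP; split; apply/eqP; apply: val_inj.
Qed.

Lemma strongly_connected_scc W :
  strongly_connected (induced W) -> exists2 x, x \in W & W \subset scc x.
Proof.
case/andP=> /card_gt0P[u _] /forallP uW.
exists (val u); first exact: valP u.
apply/subsetP => y yW; rewrite inE; apply/andP; split.
  by have := connect_induced (forallP (uW u) (exist _ y yW)).
by have := connect_induced (forallP (uW (exist _ y yW)) u).
Qed.

(** Classes of mutual reachability are strongly connected, and each strongly connected set lies in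
    one of them, so the maximal ones are the classes. *)
Lemma sccsP W : reflect (exists x, W = scc x) (W \in sccs G).
Proof.
rewrite inE; apply: (iffP maxsetP) => [[Wc Wmax]|[x ->]].
  have [x xW Wx] := strongly_connected_scc Wc.
  by exists x; rewrite (Wmax _ (scc_strongly_connected x) Wx).
split=> [|W' W'c xW']; first exact: scc_strongly_connected.
have [y _ yW'] := strongly_connected_scc W'c.
have xy : x \in scc y by apply: (subsetP yW'); apply: (subsetP xW'); exact: scc_refl.
by apply/eqP; rewrite eqEsubset xW' (scc_eq xy) yW'.
Qed.

Lemma scc_in_sccs x : scc x \in sccs G.
Proof. by apply/sccsP; exists x. Qed.

Lemma sccs_eq W x : W \in sccs G -> (x \in W) = (W == scc x).
Proof.
case/sccsP=> y ->; apply/idP/eqP => [/scc_eq //|->]; exact: scc_refl.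
Qed.

(** Minimality in the component order becomes closure under predecessors, the form in which it is
    used on edges. *)
Lemma initialP W :
  reflect (W \in sccs G /\ forall x y, y \in W -> connect (@adj n G) x y -> x \in W)
          (W \in initial_components G).
Proof.
rewrite /initial_components [X in reflect _ X]in_set; apply: (iffP andP) => -[Ws WP]; split=> //.
  move=> x y yW xy.
  have := forallP WP (scc x); rewrite scc_in_sccs sccs_eq // eq_sym /=.
  move/implyP; apply; apply/existsP; exists x; rewrite scc_refl.
  by apply/existsP; exists y; rewrite yW.
apply/forallP => W'; apply/implyP => W's; apply/implyP.
case/existsP=> x /andP[xW' /existsP[y /andP[yW xy]]].
have := WP _ _ yW xy; rewrite sccs_eq // => /eqP ->.
by rewrite -sccs_eq.
Qed.

(** By the cut condition [r] reaches every vertex, so whatever reaches its component also belongs to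
    it. *)
Lemma root_initial A r : rooted_on setT A r -> scc r \in initial_components G.
Proof.
move=> rA; apply/initialP; split; first exact: scc_in_sccs.
have reach z : connect (@adj n G) r z.
  case: rA => _ _ cut; pose U := [set z | ~~ connect (@adj n G) r z].
  have [U0|Un0] := eqVneq U set0.
    by have := in_set0 z; rewrite -U0 inE => /negbFE.
  have [|e _] := cut U (subsetT _) Un0; first by rewrite inE negbK connect0.
  rewrite !inE negbK => /andP[/negP rt rs]; case: rt.
  exact: connect_trans rs (connect_edge e).
move=> x y; rewrite !inE => /andP[_ yr] xy.
by rewrite reach; exact: connect_trans xy yr.
Qed.

Definition num_ancestors x := #|[set y | connect (@adj n G) y x]|.

(** Ancestors of the tail are ancestors of [x], but [x] is not an ancestor of the tail, as otherwise
    the tail would lie in the component of [x]. *)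
Lemma num_ancestors_lt (e : edge G) x :
  tgt e \in scc x -> src e \notin scc x -> num_ancestors (src e) < num_ancestors x.
Proof.
rewrite !inE => /andP[xt tx] sx; apply: proper_card; apply/properP.
have sx' : connect (@adj n G) (src e) x := connect_trans (connect_edge e) tx.
split; first by apply/subsetP => y; rewrite !inE => ys; exact: connect_trans ys sx'.
exists x; rewrite !inE ?connect0 //.
by apply: contra sx => ->.
Qed.

Lemma rooted_on_sccs A r :
  rooted_on setT A r <-> forall W, W \in sccs G -> rooted_on W A r.
Proof.
split=> [[rA injA cut] W Ws|rA].
  split=> [e eA _|e f|S _]; first by apply: rA; rewrite ?inE.
    by rewrite !inE => /andP[eA _] /andP[fA _]; apply: injA; rewrite inE ?eA ?fA inE.
  exact/cut/subsetT.
split.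
(* The first two conditions each look at a single head, hence at a single component. *)
- by move=> e eA _; have [h _ _] := rA _ (scc_in_sccs (tgt e)); apply: h eA (scc_refl _).
- move=> e f; rewrite !inE !andbT => eA fA ef.
  have [_ h _] := rA _ (scc_in_sccs (tgt e)).
  by apply: h => //; rewrite in_set ?eA ?fA -?ef scc_refl.
- move=> S _ /set0Pn[x0 x0S] rS.
  case: (arg_minnP num_ancestors x0S) => x xS' xmin.
  have xS : x \in S := xS'.
  have [_ _ cut] := rA _ (scc_in_sccs x).
  have [|||e eA] := cut (S :&: scc x); first exact: subsetIr.
  - by apply/set0Pn; exists x; rewrite in_setI xS scc_refl.
  - by rewrite in_setI (negbTE rS).
  rewrite in_setI => /andP[/andP[tS tx] sx]; exists e => //; rewrite tS /=.
  apply: contra sx => sS; rewrite in_setI sS /=.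
  by apply/negPn/negP => /(num_ancestors_lt tx); rewrite ltnNge xmin.
Qed.

End Components.

(** * Expanding the product of Kirchhoff polynomials *)

Section Kirchhoff.
Variables (n : nat) (G : digraph n).
Local Open Scope ring_scope.

(** This brings the polynomials of all [hat W] to sums over one common type, the edge sets of
    [G]. *)
Lemma kirchhoff_embed (D : digraph n) (f : edge D -> edge G) :
    injective f -> (forall e, label (f e) = label e) ->
  kirchhoff D = \sum_(B : {set edge G} | (B \subset codom f) && (f @^-1: B \in arb D))
                  \prod_(e in B) 'X_(label e).
Proof.
move=> f_inj f_label; rewrite /kirchhoff.
rewrite (reindex_onto (fun A : {set edge D} => f @: A) (fun B => f @^-1: B)) /=; last first.
  move=> B /andP[/subsetP Bf _]; apply/setP => e; apply/imsetP/idP.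
    by case=> x; rewrite inE => xB ->.
  by move=> eB; have /codomP[x ex] := Bf e eB; exists x; rewrite ?inE -?ex.
have preK (A : {set edge D}) : f @^-1: (f @: A) = A by apply/setP => e; rewrite inE mem_imset.
apply: eq_big => [A|A _].
  rewrite preK eqxx andbT; symmetry; apply/andb_idl => _.
  by apply/subsetP => _ /imsetP[x _ ->]; exact: codom_f.
rewrite big_imset /=; last by move=> x y _ _; exact: f_inj.
by apply: eq_bigr => e _; rewrite f_label.
Qed.

Definition heads_in (W : {set vertex G}) : {set edge G} := [set e | tgt e \in W].

Lemma sum_over_pieces (P : {set edge G} -> bool)
    (Q : {set vertex G} -> {set edge G} -> bool) :
    (forall A, P A = [forall W in sccs G, Q W (A :&: heads_in W)]) ->
  \sum_(A | P A) \prod_(e in A) 'X_(label e) =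
  \prod_(W in sccs G)
    \sum_(B : {set edge G} | (B \subset heads_in W) && Q W B)
      \prod_(e in B) 'X_(label e) :> {mpoly int[n]}.
Proof.
(* The product becomes a sum over families of pieces, with [set0] as the value off [sccs]; [cut]
   must use the same default to be inverse to [glue]. *)
move=> PQ; rewrite (big_distr_big_dep set0) /=.
pose cut A := [ffun W => if W \in sccs G then A :&: heads_in W else set0].
pose glue (F : {ffun {set vertex G} -> {set edge G}}) := \bigcup_(W in sccs G) F W.
have cutK A : glue (cut A) = A.
  apply/setP => e; apply/bigcupP/idP => [[W Ws]|eA].
    by rewrite ffunE Ws inE => /andP[].
  exists (scc (tgt e)); first exact: scc_in_sccs.
  by rewrite ffunE scc_in_sccs inE eA inE scc_refl.
have sub_glue (F : {ffun {set vertex G} -> {set edge G}}) W :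
    (forall W', W' \in sccs G -> F W' \subset heads_in W') ->
    W \in sccs G -> glue F :&: heads_in W = F W.
  move=> sF Ws; apply/setP => e; rewrite in_setI; apply/andP/idP => [[]|eF].
    case/bigcupP=> W' W's eW'; rewrite inE sccs_eq // => /eqP ->.
    have := subsetP (sF _ W's) _ eW'; rewrite inE sccs_eq // => /eqP <-.
    by [].
  by split; [apply/bigcupP; exists W | exact: (subsetP (sF _ Ws))].
rewrite [RHS](reindex_onto cut glue) /=; last first.
  move=> F /pfamilyP[F0 FP]; apply/ffunP => W; rewrite ffunE.
  case: ifP => [Ws|/negbT Ws].
    by apply: sub_glue => // W' /FP /andP[].
  by symmetry; apply/eqP; apply: contraNT Ws => /(subsetP F0).
apply: eq_big => [A|A _].
  rewrite cutK eqxx andbT PQ; apply/forall_inP/pfamilyP => [AP|[_ AP] W Ws].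
    split=> [|W Ws]; last by rewrite ffunE Ws unfold_in subsetIr AP.
    by apply/subsetP => W; rewrite inE ffunE; case: ifP => //; rewrite eqxx.
  by have := AP W Ws; rewrite ffunE Ws unfold_in => /andP[].
(* The monomial of [A] factors by grouping its edges according to the component of the head. *)
rewrite (partition_big (fun e => scc (tgt e)) (mem (sccs G))) /=; last first.
  by move=> e _; exact: scc_in_sccs.
apply: eq_bigr => W Ws; apply: eq_bigl => e.
by rewrite ffunE Ws in_setI inE sccs_eq // eq_sym.
Qed.

End Kirchhoff.

Theorem theorem4p1 (n : nat) (G : digraph n)
    (label_inj : injective (@label n G))
    (G_connected : connected G)
    (one_initial : #|initial_components G| = 1) :
  kirchhoff G = (\prod_(W in sccs G) kirchhoff (hat W))%R.
Proof.
have [W0 initE] : exists W0, initial_components G = [set W0].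
  by apply/cards1P; rewrite one_initial.
have /initialP [W0s W0in] : W0 \in initial_components G by rewrite initE inE.
(* No edge enters [W0], so [induced W0] contains every edge with head in [W0]. *)
have W0closed (e : edge G) : tgt e \in W0 -> src e \in W0.
  by move=> tW; apply: W0in tW (connect_edge e).
have W0_disj W r : W \in sccs G -> W != W0 -> r \in W0 -> r \notin W.
  by move=> Ws WW0; rewrite !sccs_eq // => /eqP <-.
have [r0 r0W0] : exists r, r \in W0.
  by case/sccsP: W0s => x ->; exists x; exact: scc_refl.
(* For [W0] the vertex [r] is the actual root; for any other component it lies outside and stands
   for the auxiliary vertex. *)
pose Q (W : {set vertex G}) A := `[< exists2 r, r \in W0 & rooted_on W A r >].
(* The criterion on [W] sees only edges with head in [W], so it can be tested on the piece of [A]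
   there. *)
have rooted_cap W (A : {set edge G}) r :
    rooted_on W (A :&: heads_in W) r <-> rooted_on W A r.
  split=> -[rA injA cut]; split.
  - by move=> e eA tW; apply: rA; rewrite // !inE eA.
  - move=> e f; rewrite !inE => /andP[eA tW] /andP[fA uW].
    by apply: injA; rewrite !inE ?eA ?fA ?tW ?uW.
  - move=> S SW S0 rS; have [e] := cut S SW S0 rS.
    by rewrite inE => /andP[eA _] ?; exists e.
  - by move=> e; rewrite inE => /andP[eA _]; apply: rA.
  - move=> e f; rewrite !inE => /andP[/andP[eA _] tW] /andP[/andP[fA _] uW].
    by apply: injA; rewrite !inE ?eA ?fA ?tW ?uW.
  - move=> S SW S0 rS; have [e eA eS] := cut S SW S0 rS; exists e => //.
    by case/andP: eS => tS _; rewrite !inE eA (subsetP SW).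
(* Outside [W0] the choice of root is irrelevant, so one root serves all
   components. *)
have Q_root W A r : W \in sccs G -> W != W0 -> r \in W0 ->
    Q W A -> rooted_on W A r.
  move=> Ws WW0 rW0 /asboolP[r' r'W0 [_ injA cut]].
  have rW := W0_disj W r Ws WW0 rW0; have r'W := W0_disj W r' Ws WW0 r'W0.
  split=> // [e _ tW|S SW S0 _]; first by apply: contraNneq rW => <-.
  by apply: cut => //; apply: contra r'W; apply: (subsetP SW).
rewrite {1}/kirchhoff (@sum_over_pieces _ _ _ Q); last first.
  move=> A; rewrite inE; apply/asboolP/forall_inP => [/is_arborescenceP[r rA] W Ws|QA].
    have := root_initial rA; rewrite initE inE => /eqP rW0.
    apply/asboolP; exists r; first by rewrite -rW0 scc_refl.
    by apply/rooted_cap; apply: (rooted_on_sccs A r).1.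
  (* The piece in [W0] fixes the root, which then serves the other pieces too. *)
  have /asboolP[r rW0 /rooted_cap rA] := QA _ W0s.
  apply/is_arborescenceP; exists r; apply/rooted_on_sccs => W Ws.
  have [-> //|WW0] := eqVneq W W0.
  by apply/rooted_cap; apply: Q_root => //; exact: QA.
apply: eq_bigr => W Ws; rewrite /hat initE inE; case: eqP => [->|/eqP WW0].
  rewrite (kirchhoff_embed (@ind_val_inj _ _ W0)) //.
  apply: eq_bigl => B; congr (_ && _).
    by apply: eq_subset_r => e; rewrite inE codom_ind_val.
  rewrite inE; apply/asboolP/asboolP; by move/(induced_arborescenceP W0closed).
rewrite (kirchhoff_embed (@aug_val_inj _ _ W)); last by case.
have r0W := W0_disj W r0 Ws WW0 r0W0.
apply: eq_bigl => B; congr (_ && _).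
  by apply: eq_subset_r => e; rewrite inE codom_aug_val.
rewrite inE; apply/idP/asboolP => [QB|/(augmented_arborescenceP _ r0W) rB].
  by apply/(augmented_arborescenceP _ r0W); apply: Q_root.
by apply/asboolP; exists r0.
Qed.
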